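(* Let $A$ be a finite alphabet and let $L\subseteq A^*$ be a suffix-connected uniformly recurrent language on $A$, with $A\subseteq L$. Then the subgroups of $F(A)$ generated by the return sets of $L$ all lie in the same conjugacy class of subgroups of $F(A)$, and their rank is $n-c+1$, where $n=\mathrm{Card}(A)$ and $c$ is the number of connected components of the extension graph $\mathbf{E}(\varepsilon)$ of the empty word.
   Context: $F(A)$ is the free group on $A$, $A^*$ the set of words over $A$, $\varepsilon$ the empty word, $|w|$ the length of $w$. A language $L\subseteq A^*$ is recurrent if it is closed under taking factors and for all $u,v\in L$ there is a non-empty word $w$ with $uwv\in L$. It is uniformly recurrent if it is recurrent and for every $u\in L$ there is $N$ such that $u$ is a factor of every word of $L$ of length at least $N$. Extension graphs: for $w\in L$ and $k,l\ge 1$, let $\mathbf{L}_k(w)=\{u\in L\cap A^k: uw\in L\}$ and $\mathbf{R}_l(w)=\{v\in L\cap A^l: wv\in L\}$. The extension graph $\mathbf{E}_{k,l}(w)$ is the simple undirected bipartite graph whose vertex set is the disjoint union of (copies of) $\mathbf{L}_k(w)$ and $\mathbf{R}_l(w)$, with an edge between $u\in\mathbf{L}_k(w)$ and $v\in\mathbf{R}_l(w)$ iff $uwv\in L$. Write $\mathbf{L}=\mathbf{L}_1$, $\mathbf{R}=\mathbf{R}_1$, $\mathbf{E}=\mathbf{E}_{1,1}$. Suffix-connectedness: $\mathrm{tail}(w)$ denotes $w$ with its first letter removed. For $w\in L$ and $1\le d\le |w|+1$, let $p$ be the prefix of $w$ of length $d-1$, so $w=p\,\mathrm{tail}^{d-1}(w)$.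 The natural embedding of $\mathbf{L}(w)$ in $\mathbf{E}_{d,d}(\mathrm{tail}^{d-1}(w))$ is the map $a\mapsto ap$ from $\mathbf{L}(w)$ to $\mathbf{L}_d(\mathrm{tail}^{d-1}(w))$. The word $w$ is suffix-connected if for some $1\le d\le|w|+1$ the image of this embedding lies in one connected component of $\mathbf{E}_{d,d}(\mathrm{tail}^{d-1}(w))$. $L$ is suffix-connected if all its non-empty words are suffix-connected. Return sets: for words $u,v$ with $uv\in L$, the return set $\mathcal{R}_{u,v}$ is the set of all $r\in L$ such that $urv\in L$, $urv$ starts and ends with $uv$, and $urv$ contains exactly two occurrences of $uv$ (an occurrence of a word is a starting position; occurrences may overlap). The return sets of $L$ are the sets $\mathcal{R}_{u,v}$ for all pairs of words $(u,v)$ with $uv\in L$.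
   Formalization: The return set for u = v = ε is included only when c = 1: it equals A and generates F(A), of rank n, so the claim as stated fails for it when c > 1 (e.g. factors of (ab)^* ); all pairs with uv non-empty are covered. *)

(* Defs.v *)
From HB Require Import structures.
From mathcomp Require Import all_boot.
From mathcomp Require Import boolp classical_sets.

Set Implicit Arguments.
Unset Strict Implicit.
Unset Printing Implicit Defensive.

Local Open Scope group_scope.
Local Open Scope classical_set_scope.

Section ReducedWords.
Variable A : eqType.

(* [(a, false)] is the letter a, [(a, true)] is its formal inverse. *)
Definition letter := (A * bool)%type.
Implicit Types (x y : letter) (u v w : seq letter).

Definition linv x : letter := (x.1, ~~ x.2).

Definition reduced w := sorted (fun x y => y != linv x) w.

Definition push x w :=
  if w is y :: w' then if y == linv x then w' else x :: w else [:: x].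

Definition reduce w := foldr push [::] w.

Lemma linvK : involutive linv.
Proof. by case=> a b; rewrite /linv /= negbK. Qed.

Lemma reduced_cons x w : reduced (x :: w) -> reduced w.
Proof. exact: path_sorted. Qed.

Lemma reduced_push x w : reduced w -> reduced (push x w).
Proof.
case: w => [|y w] //= rw; case: ifPn => [_|yx]; first exact: path_sorted rw.
by rewrite /reduced /= yx.
Qed.

Lemma reduced_act u w : reduced w -> reduced (foldr push w u).
Proof. by move=> rw; elim: u => //= x u; apply: reduced_push. Qed.

Lemma reduced_reduce w : reduced (reduce w).
Proof. exact: reduced_act. Qed.

Lemma reduce_cons x w : reduce (x :: w) = push x (reduce w).
Proof. by []. Qed.

Lemma reduce_id w : reduced w -> reduce w = w.
Proof.
elim: w => // x w IH xw; rewrite reduce_cons IH ?(reduced_cons xw) //.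
by case: w xw {IH} => //= y w /andP[/negPf ->].
Qed.

Lemma pushK x w : reduced w -> push x (push (linv x) w) = w.
Proof.
case: w => [|y w] /=; first by rewrite eqxx.
rewrite linvK; case: eqP => [-> | _ _] /=; last by rewrite eqxx.
by case: w => [|z w] //= /andP[/negPf ->].
Qed.

Lemma act_push x u w :
  reduced w -> foldr push w (push x u) = push x (foldr push w u).
Proof.
case: u => //= y u rw; case: eqP => [->|//].
by rewrite pushK //; apply: reduced_act.
Qed.

Lemma act_reduce u w : reduced w -> foldr push w (reduce u) = foldr push w u.
Proof. by move=> rw; elim: u => //= x u IH; rewrite act_push // IH. Qed.

Lemma reduce_catl u v : reduce (reduce u ++ v) = reduce (u ++ v).
Proof. by rewrite /reduce !foldr_cat act_reduce //; apply: reduced_reduce. Qed.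

Lemma reduce_catr u v : reduce (u ++ reduce v) = reduce (u ++ v).
Proof.
by rewrite {1 3}/reduce !foldr_cat -!/(reduce _) reduce_id ?reduced_reduce.
Qed.

Definition winv w := rev (map linv w).

Lemma winvK : involutive winv.
Proof. by move=> w; rewrite /winv map_rev revK (mapK linvK). Qed.

Lemma reduced_winv w : reduced w -> reduced (winv w).
Proof.
rewrite /reduced /winv rev_sorted sorted_map; apply: sub_sorted => x y /=.
by apply: contra => /eqP ->; rewrite linvK.
Qed.

Lemma reduce_winvl w : reduce (winv w ++ w) = [::].
Proof.
elim: w => // x w IH; rewrite /winv map_cons rev_cons cat_rcons.
rewrite -reduce_catr !reduce_cons -{2}[x]linvK pushK ?reduced_reduce //.
by rewrite reduce_catr.
Qed.

Lemma reduce_winvr w : reduce (w ++ winv w) = [::].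
Proof. by rewrite -{1}[w]winvK reduce_winvl. Qed.

End ReducedWords.

Record freeGroup (A : eqType) :=
  FreeGroup { fgval :> seq (letter A); fgvalP : reduced fgval }.

HB.instance Definition _ (A : eqType) := [isSub for @fgval A].
HB.instance Definition _ (A : eqType) := [Equality of freeGroup A by <:].
HB.instance Definition _ (A : choiceType) := [Choice of freeGroup A by <:].

Section FreeGroupOps.
Variable A : choiceType.
Implicit Types x y z : freeGroup A.

Definition fg_one : freeGroup A := @FreeGroup A [::] isT.
Definition fg_mul x y : freeGroup A :=
  FreeGroup (reduced_reduce (fgval x ++ fgval y)).
Definition fg_inv x : freeGroup A := FreeGroup (reduced_winv (fgvalP x)).

Fact fg_mulA : associative fg_mul.
Proof.
by move=> x y z; apply: val_inj; rewrite /= reduce_catl reduce_catr catA.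
Qed.
Fact fg_mul1 : left_id fg_one fg_mul.
Proof. by move=> x; apply: val_inj; rewrite /= reduce_id //; apply: fgvalP. Qed.
Fact fg_mulr1 : right_id fg_one fg_mul.
Proof.
by move=> x; apply: val_inj; rewrite /= cats0 reduce_id //; apply: fgvalP.
Qed.
Fact fg_mulV : left_inverse fg_one fg_inv fg_mul.
Proof. by move=> x; apply: val_inj; rewrite /= reduce_winvl. Qed.
Fact fg_mulrV : right_inverse fg_one fg_inv fg_mul.
Proof. by move=> x; apply: val_inj; rewrite /= reduce_winvr. Qed.

HB.instance Definition _ :=
  isGroup.Build (freeGroup A) fg_mulA fg_mul1 fg_mulr1 fg_mulV fg_mulrV.

Definition fg_gen (a : A) : freeGroup A := @FreeGroup A [:: (a, false)] isT.

Definition fg_word (w : seq A) : freeGroup A := \prod_(a <- w) fg_gen a.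

(* The morphism from F(A) to G extending f : A -> G. *)
Definition fg_lift (G : groupType) (f : A -> G) (x : freeGroup A) : G :=
  \prod_(l <- fgval x) (if l.2 then (f l.1)^-1 else f l.1).

Lemma fg_lift_gen (G : groupType) (f : A -> G) a : fg_lift f (fg_gen a) = f a.
Proof. by rewrite /fg_lift big_seq1. Qed.

Lemma fg_liftM (G : groupType) (f : A -> G) :
  {morph fg_lift f : x y / x * y}.
Proof.
move=> x y; rewrite /fg_lift /=; elim: (fgval x) => [|l w IH].
  by rewrite reduce_id ?fgvalP // big_nil mul1g.
rewrite cat_cons reduce_cons big_cons -mulgA -IH.
case: (reduce _) => [|m r] /=; first by rewrite !big_cons.
case: eqP => [-> | _]; rewrite !big_cons //=.
by case: l => a [] /=; rewrite mulgA ?mulVg ?mulgV mul1g.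
Qed.

End FreeGroupOps.

Section Subgroups.
Variable G : groupType.
Implicit Types (S H K : set G).

Definition is_subgroup H : Prop := group_closed [in H].

Definition generated S : set G := smallest is_subgroup S.

Definition conjugate_subgroups H K : Prop :=
  exists g : G, K = [set x ^ g | x in H].

(* X is a basis of H when the canonical morphism from the free group on the   *)
(* index set of X to G is injective with image H.                             *)
Definition free_basis (I : choiceType) (X : I -> G) H : Prop :=
  injective (fg_lift X) /\ range (fg_lift X) = H.

(* All bases of a free group have the same cardinality, so at most one k      *)
(* satisfies has_rank H k.                                                    *)
Definition has_rank H (k : nat) : Prop :=
  exists X : 'I_k -> G, free_basis X H.

End Subgroups.

Section Languages.
Variables (A : finType) (L : set (seq A)).
Implicit Types u v w r : seq A.

Definition recurrent : Prop :=
  (forall u w, infix u w -> L w -> L u) /\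
  (forall u v, L u -> L v -> exists2 w, w <> [::] & L (u ++ w ++ v)).

Definition uniformly_recurrent : Prop :=
  recurrent /\
  forall u, L u ->
    exists N, forall w, L w -> N <= size w -> infix u w.

Definition left_ext k w : {pred k.-tuple A} :=
  fun s => (tval s \in L) && (s ++ w \in L).
Definition right_ext l w : {pred l.-tuple A} :=
  fun t => (tval t \in L) && (w ++ t \in L).
Arguments left_ext : clear implicits.
Arguments right_ext : clear implicits.

(* The graph E_{k,l}(w): a vertex is an [inl s] with s in L_k(w), or an       *)
(* [inr t] with t in R_l(w). Other elements of the carrier type are not       *)
(* vertices.                                                                  *)
Definition extg_vertex k l w : {pred k.-tuple A + l.-tuple A} :=
  fun x => match x with
           | inl s => s \in left_ext k w
           | inr t => t \in right_ext l w
           end.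
Arguments extg_vertex : clear implicits.

Definition extg_edge k l w : rel (k.-tuple A + l.-tuple A) :=
  fun x y => match x, y with
    | inl s, inr t | inr t, inl s =>
        [&& s \in left_ext k w, t \in right_ext l w & s ++ w ++ t \in L]
    | _, _ => false
    end.
Arguments extg_edge : clear implicits.

Lemma extg_edge_sym k l w : symmetric (extg_edge k l w).
Proof. by case=> s [] t. Qed.

Lemma extg_vertex_closed k l w :
  fingraph.closed (extg_edge k l w) (extg_vertex k l w).
Proof.
by move=> [s|t] [s'|t'] //= /and3P[ws wt _]; rewrite -!topredE /= ws wt.
Qed.

Definition extg_ncomp k l w : nat :=
  n_comp (extg_edge k l w) (extg_vertex k l w).

(* The image of the natural embedding of L(w) in E_{d,d}(tail^{d-1}(w)),      *)
(* which maps a to ap, where p is the prefix of w of length d - 1.            *)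
Definition nat_embedding_image d w : {pred d.-tuple A} :=
  fun s => [exists a : A,
    ([tuple a] \in left_ext 1 w) && (tval s == a :: take d.-1 w)].
Arguments nat_embedding_image : clear implicits.

Definition suffix_connected_word w : Prop :=
  exists2 d, 1 <= d <= (size w).+1 &
    {in nat_embedding_image d w &, forall s t,
      connect (extg_edge d d (drop d.-1 w)) (inl s) (inl t)}.

Definition suffix_connected : Prop :=
  forall w, L w -> w <> [::] -> suffix_connected_word w.

(* Number of starting positions of x in y; the empty word occurs at all       *)
(* positions from 0 to size y included.                                       *)
Definition occurrences (x y : seq A) : nat :=
  count (fun i => prefix x (drop i y)) (iota 0 (size y).+1).

Definition return_set u v : set (seq A) :=
  [set r | [/\ L r, L (u ++ r ++ v),
               prefix (u ++ v) (u ++ r ++ v),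
               suffix (u ++ v) (u ++ r ++ v) &
               occurrences (u ++ v) (u ++ r ++ v) = 2]].

Definition return_group u v : set (freeGroup A) :=
  generated [set fg_word r | r in return_set u v].

(* The pairs (u, v) indexing the return sets. The set R_{[::],[::]} is A,     *)
(* which generates F(A), of rank n; this has the rank n - c + 1 of the other  *)
(* return groups only if c = 1. For instance, for the factors of (ab)^* one   *)
(* has c = 2 and R_{a,[::]} = {ba}. So the pair ([::], [::]) is kept only     *)
(* when c = 1.                                                                *)
Definition return_pair u v : Prop :=
  L (u ++ v) /\ (u ++ v = [::] -> extg_ncomp 1 1 [::] = 1%N).

End Languages.

Arguments left_ext {A} L k w.
Arguments right_ext {A} L l w.
Arguments extg_vertex {A} L k l w.
Arguments extg_edge {A} L k l w.
Arguments nat_embedding_image {A} L d w.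

(* Main.v *)
Require Import Defs.
From mathcomp Require Import all_boot.
From mathcomp Require Import boolp classical_sets.

(** Return words are labels of loops in the Rauzy graphs of L. The Rauzy graph
of order m has the words of L of length m as vertices, and each word x b of L
of length m + 1 is an edge, labelled b, from its prefix x to its suffix of
length m. Walks may follow edges backwards, so the labels of the loops at a
vertex x form a subgroup of F(A).

The order m >= 1 does not matter. Dropping the first letter maps the graph of order
m + 1 onto the graph of order m, and a walk of order m can be lifted back as
soon as any two vertices a x and b x with the same suffix x are joined by a
walk with trivial label. That is exactly what suffix-connectedness gives: an
edge s - r of E_{d,d}(t) is the word s t r of L, hence a walk labelled r from
s t to t r; going along s - r - s' spells r and then its inverse. Hence the
loops at a word of L depend only on its last letter ([loops_rauzy_cat]).

A return word r of (u,v) satisfies u r v = u v s for a loop label s at u v,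
and s is the conjugate of r by v. Conversely, by uniform recurrence, take M so
large that all words of L of length M contain u v, and send such a word x to
the part of x that follows the last occurrence of u v. Along an edge this part
either grows by the letter read or has just completed a return to u v and
starts again from the empty word; so it trivialises, modulo the group of
returns, every loop of order M at a word ending in u v
([return_group_loops]).

It remains to treat order 1. There, letters in the same component of E(epsilon)
are joined by walks with trivial label; merging them leaves a connected graph
whose vertices are the c components and which has exactly one edge labelled b
for every letter b, from the component of the right copy of b to that of the
left copy ([comp_walk_rauzy]). For a graph with edges labelled by distinct
generators, closing up the edges outside a spanning tree gives a basis of the
loop group ([graph_rank]), so the rank is n - (c - 1). Connectedness makes the
loop groups at all vertices conjugate. *)

Set Implicit Arguments.
Unset Strict Implicit.
Unset Printing Implicit Defensive.

Local Open Scope group_scope.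
Local Open Scope classical_set_scope.

(** * Subgroups and conjugacy *)

Section SubgroupFacts.
Variable G : groupType.
Implicit Types (S H K : set G) (g h : G).

Lemma is_subgroupP H :
  is_subgroup H <->
  [/\ H 1, (forall g h, H g -> H h -> H (g * h)) & forall g, H g -> H g^-1].
Proof.
split=> [sH | [H1 HM HV]].
  have HV := group_closedV sH; have HM := group_closedM sH.
  split=> [|g h /mem_set Hg /mem_set Hh|g /mem_set Hg]; apply: set_mem.
  - exact: sH.1.
  - exact: HM.
  - exact: HV.
split=> [|g h /set_mem Hg /set_mem Hh]; apply: mem_set => //.
exact/HM/HV.
Qed.

Lemma generated_is_subgroup S : is_subgroup (generated S).
Proof.
apply/is_subgroupP; split.
- by move=> K [/is_subgroupP[]].
- move=> g h gS hS K KP; have [/is_subgroupP[_ KM _] _] := KP.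
  by apply: KM; [apply: gS | apply: hS].
- move=> g gS K KP; have [/is_subgroupP[_ _ KV] _] := KP.
  by apply: KV; apply: gS.
Qed.

Lemma conj_is_subgroup g H : is_subgroup H -> is_subgroup [set h | H (h ^ g)].
Proof.
move=> /is_subgroupP[H1 HM HV]; apply/is_subgroupP; split=> /=.
- by rewrite conj1g.
- by move=> h k Hh Hk; rewrite conjMg; apply: HM.
- by move=> h Hh; rewrite conjVg; apply: HV.
Qed.

Lemma conjugate_subgroups_of g H K :
  (forall h, K h <-> H (h ^ g)) -> conjugate_subgroups H K.
Proof.
move=> HK; exists g^-1; apply/seteqP; split=> [h /HK Hh | _ [h Hh <-]] /=.
  by exists (h ^ g); rewrite ?conjgK.
by apply/HK; rewrite conjgKV.
Qed.

Lemma conjugate_subgroups_sym H K :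
  conjugate_subgroups H K -> conjugate_subgroups K H.
Proof.
case=> g ->; apply: (@conjugate_subgroups_of g) => h.
by split=> [|[k Hk /conjg_inj <-]] //; exists h.
Qed.

Lemma conjugate_subgroups_trans H K S :
  conjugate_subgroups H K -> conjugate_subgroups K S ->
  conjugate_subgroups H S.
Proof.
case=> g -> [h ->]; exists (g * h).
rewrite image_comp; by apply: eq_imagel => k _ /=; rewrite conjgM.
Qed.

End SubgroupFacts.

(** * Morphisms out of a free group *)

Section FreeGroupFacts.
Variable A : choiceType.
Implicit Types (x y : freeGroup A) (u v : seq A).

Lemma fg_word_rcons u a : fg_word (rcons u a) = fg_word u * fg_gen a.
Proof. by rewrite /fg_word -cats1 big_cat big_seq1. Qed.

Lemma fg_word_cat u v : fg_word (u ++ v) = fg_word u * fg_word v.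
Proof. by rewrite /fg_word big_cat. Qed.

Lemma fg_word_cons a u : fg_word (a :: u) = fg_gen a * fg_word u.
Proof. by rewrite /fg_word big_cons. Qed.

Variable G : groupType.
Implicit Types f : A -> G.

Lemma fg_lift1 f : fg_lift f 1 = 1.
Proof. by rewrite /fg_lift big_nil. Qed.

Lemma fg_liftV f x : fg_lift f x^-1 = (fg_lift f x)^-1.
Proof. by apply/(mulgI (fg_lift f x)); rewrite -fg_liftM !mulgV fg_lift1. Qed.

Lemma fg_lift_prod f (I : Type) (s : seq I) (F : I -> freeGroup A) :
  fg_lift f (\prod_(i <- s) F i) = \prod_(i <- s) fg_lift f (F i).
Proof. exact: (big_morph _ (@fg_liftM _ _ f) (fg_lift1 f)). Qed.

Lemma fg_lift_subgroup f (H : set G) x :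
  is_subgroup H -> (forall a, H (f a)) -> H (fg_lift f x).
Proof.
move=> /is_subgroupP[H1 HM HV] Hf; rewrite /fg_lift.
by apply: big_ind => // -[a []] _ //=; apply: HV.
Qed.

Lemma range_fg_lift_is_subgroup f : is_subgroup (range (fg_lift f)).
Proof.
apply/is_subgroupP; split.
- by exists 1; rewrite ?fg_lift1.
- by move=> _ _ [x _ <-] [y _ <-]; exists (x * y); rewrite ?fg_liftM.
- by move=> _ [x _ <-]; exists x^-1; rewrite ?fg_liftV.
Qed.

End FreeGroupFacts.

Lemma fg_lift_id (A : choiceType) : fg_lift (@fg_gen A) =1 id.
Proof.
move=> x; apply: val_inj; rewrite -[RHS](reduce_id (fgvalP x)) /fg_lift /=.
elim: (fgval x) => [|[a b] w IH]; first by rewrite big_nil.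
rewrite big_cons reduce_cons -IH.
by case: b; rewrite /= -/(reduce _) (reduce_id (fgvalP _)).
Qed.

(** The criterion used to prove that a family f is free: a morphism that sends
each f a back to the generator a is a retraction of the lift of f. *)
Lemma fg_liftK (A B : choiceType) (f : A -> freeGroup B)
    (h : B -> freeGroup A) :
  (forall a, fg_lift h (f a) = fg_gen a) -> cancel (fg_lift f) (fg_lift h).
Proof.
move=> hf x; rewrite -[RHS]fg_lift_id [fg_lift f x]/fg_lift fg_lift_prod.
by apply: eq_bigr => -[a []] _ //=; rewrite ?fg_liftV hf.
Qed.

Lemma has_rank_conj (G : groupType) (H K : set G) k :
  conjugate_subgroups H K -> has_rank H k -> has_rank K k.
Proof.
case=> g ->{K} [X [Xinj XH]]; exists (fun i => X i ^ g).
have liftJ : fg_lift (fun i => X i ^ g) =1 (fun x => fg_lift X x ^ g).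
  move=> x; rewrite /fg_lift conjg_prod.
  by apply: eq_bigr => -[i []] _ //=; rewrite conjVg.
split=> [x y|]; first by rewrite !liftJ => /conjg_inj /Xinj.
by rewrite -XH image_comp; apply: eq_imagel => x _; rewrite liftJ.
Qed.

(** * Walks in a graph labelled by a group *)

Section Walks.
Variables (V : Type) (G : groupType) (E : V -> G -> V -> Prop).
Implicit Types (x y z : V) (g h : G).

Inductive walk : V -> G -> V -> Prop :=
| walk_nil x : walk x 1 x
| walk_fwd x g y h z : E x g y -> walk y h z -> walk x (g * h) z
| walk_bwd x g y h z : E y g x -> walk y h z -> walk x (g^-1 * h) z.

Definition loops x : set G := [set g | walk x g x].

Lemma walk_edge x g y : E x g y -> walk x g y.
Proof. by move=> xy; rewrite -[g]mulg1; apply: walk_fwd xy (walk_nil y). Qed.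

Lemma walk_trans y x z g h : walk x g y -> walk y h z -> walk x (g * h) z.
Proof.
move=> xy; elim: xy h z => {x g y} [x|x g y g' z xy _ IH|x g y g' z yx _ IH] h t.
- by rewrite mul1g.
- by rewrite -mulgA => /IH; apply: walk_fwd.
- by rewrite -mulgA => /IH; apply: walk_bwd.
Qed.

Lemma walk_sym x y g : walk x g y -> walk y g^-1 x.
Proof.
elim=> {x g y} [x|x g y h z xy _ IH|x g y h z yx _ IH].
- by rewrite invg1; apply: walk_nil.
- rewrite invgM; apply: (walk_trans IH).
  by rewrite -[g^-1]mulg1; apply: walk_bwd xy (walk_nil x).
- by rewrite invgM invgK; apply: (walk_trans IH); apply: walk_edge.
Qed.

Lemma walk_trans1 y x z h : walk x 1 y -> walk y h z -> walk x h z.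
Proof. by move=> xy yz; rewrite -[h]mul1g; apply: walk_trans xy yz. Qed.

Lemma loops_is_subgroup x : is_subgroup (loops x).
Proof.
apply/is_subgroupP; split=> [|g h|g]; first exact: walk_nil.
  exact: walk_trans.
exact: walk_sym.
Qed.

(** Relabelling each vertex x by phi x changes the label g of an edge from p to q
into phi p * g * (phi q)^-1, and these telescope along a walk; it is thus
enough to find the new labels of edges in H. *)
Lemma walk_cocycle (H : set G) (phi : V -> G) x g y :
  is_subgroup H ->
  (forall p h q, E p h q -> H (phi p * h * (phi q)^-1)) ->
  walk x g y -> H (phi x * g * (phi y)^-1).
Proof.
move=> /is_subgroupP[H1 HM HV] EH.
elim=> {x g y} [x|x g y h z xy _ IH|x g y h z yx _ IH].
- by rewrite mulg1 mulgV.
- by move: (HM _ _ (EH _ _ _ xy) IH); rewrite !mulgA mulgVK.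
- have /HV := EH _ _ _ yx; rewrite !invgM invgK => Hg.
  by move: (HM _ _ Hg IH); rewrite !mulgA mulgVK.
Qed.

Lemma walk_closed (P : V -> Prop) x g y :
  (forall p h q, E p h q -> P p <-> P q) -> walk x g y -> P x -> P y.
Proof.
move=> PE; elim=> {x g y} // [x g y h z xy _ IH|x g y h z yx _ IH] Px.
  by apply/IH/(PE _ _ _ xy).
by apply/IH/(PE _ _ _ yx).
Qed.

Lemma loops_conjugate x y g : walk x g y -> conjugate_subgroups (loops x) (loops y).
Proof.
move=> xy; have yx := walk_sym xy.
apply: (@conjugate_subgroups_of _ g^-1) => h; rewrite conjgE invgK.
split=> [yhy | xhx]; first exact: walk_trans xy (walk_trans yhy yx).
have := walk_trans yx (walk_trans xhx xy).
by rewrite /loops /= -!mulgA mulVg mulg1 mulKg.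
Qed.

End Walks.

Lemma walk_map (V W : Type) (G : groupType) (E : V -> G -> V -> Prop)
    (F : W -> G -> W -> Prop) (f : V -> W) x g y :
  (forall p h q, E p h q -> walk F (f p) h (f q)) ->
  walk E x g y -> walk F (f x) g (f y).
Proof.
move=> EF; elim=> {x g y} [x|x g y h z xy _|x g y h z yx _].
- exact: walk_nil.
- exact: walk_trans (EF _ _ _ xy).
- exact: walk_trans (walk_sym (EF _ _ _ yx)).
Qed.

(** * Rank of the loop group of a graph with freely labelled edges *)

Section GraphRank.
Variables (A V : finType) (src tgt : A -> V).

Definition edge_in (T : {set A}) (p : V) (g : freeGroup A) (q : V) : Prop :=
  exists2 b, b \in T & [/\ p = src b, g = fg_gen b & q = tgt b].

Lemma walk_edge_in_sub (T T' : {set A}) p g q :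
  T \subset T' -> walk (edge_in T) p g q -> walk (edge_in T') p g q.
Proof.
move=> sTT; apply: (@walk_map _ _ _ _ _ id) => {}p {}g {}q [b bT bE].
by apply: walk_edge; exists b => //; apply: (fintype.subsetP sTT).
Qed.

Variables (C : {set V}) (r : V).
Hypothesis rC : r \in C.
Hypothesis srcC : forall b, src b \in C.
Hypothesis tgtC : forall b, tgt b \in C.
Hypothesis connC :
  forall v, v \in C -> exists g, walk (edge_in finset.setT) r g v.

(** T is the edge set of the tree and tau v the label of the tree walk from r to
v. The tree is grown one vertex at a time: as long as a set S of vertices
containing r is not all of C, connectedness provides an edge with exactly one
end in S. *)
Lemma exists_spanning_tree :
  exists (T : {set A}) (tau : V -> freeGroup A),
    [/\ #|T|.+1 = #|C|, tau r = 1,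
        forall v, v \in C -> walk (edge_in T) r (tau v) v &
        forall b, b \in T -> tau (src b) * fg_gen b = tau (tgt b)].
Proof.
pose good (S : {set V}) (T : {set A}) (tau : V -> freeGroup A) :=
  [/\ r \in S, S \subset C & #|T|.+1 = #|S|] /\
  [/\ tau r = 1, forall v, v \in S -> walk (edge_in T) r (tau v) v &
      forall b, b \in T -> [/\ src b \in S, tgt b \in S &
                               tau (src b) * fg_gen b = tau (tgt b)]].
have grow n : n < #|C| -> exists S T tau, good S T tau /\ #|S| = n.+1; last first.
  have C_gt0 : 0 < #|C| by apply/card_gt0P; exists r.
  have [|S [T [tau [[[_ sSC cardT] [taur walkT tauT]] cardS]]]] := grow #|C|.-1.
    by rewrite prednK.
  have eqSC : S = C by apply/eqP; rewrite eqEcard sSC cardS prednK /=.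
  exists T, tau; split=> //; first by rewrite cardT eqSC.
    by move=> v; rewrite -eqSC; apply: walkT.
  by move=> b /tauT[].
elim: n => [_|k IH ltkC].
  exists [set r]%SET, finset.set0, (fun=> 1); rewrite cards1; split=> //.
  split; first by rewrite inE eqxx finset.sub1set cards0 cards1.
  split=> [|v|b]; [by []| |by rewrite finset.in_set0].
  by rewrite inE => /eqP ->; apply: walk_nil.
have [S [T [tau [[[rS sSC cardT] [taur walkT tauT]] cardS]]]] := IH (ltnW ltkC).
have add v b t : v \in C -> v \notin S -> b \notin T ->
    walk (edge_in (b |: T)) r t v ->
    src b \in v |: S -> tgt b \in v |: S ->
    let tau' x := if x == v then t else tau x in
    tau' (src b) * fg_gen b = tau' (tgt b) ->
    exists S T tau, good S T tau /\ #|S| = k.+2.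
  move=> vC vS bT wv srcS tgtS tau' tau'b.
  have tau'E x : x \in S -> tau' x = tau x.
    by rewrite /tau'; case: eqP => // -> /(negP vS).
  exists (v |: S), (b |: T), tau'; rewrite cardsU1 vS cardS; split=> //.
  split; first split.
  - by rewrite inE rS orbT.
  - by rewrite finset.subUset finset.sub1set vC.
  - by rewrite !cardsU1 bT vS !add1n cardT.
  split=> [|x|c].
  - by rewrite tau'E.
  - case/finset.setU1P => [->|xS]; first by rewrite /tau' eqxx.
    by rewrite tau'E //; apply: walk_edge_in_sub (walkT _ xS); apply: finset.subsetU1.
  - case/finset.setU1P => [->|/tauT[sS tS e]] //.
    by rewrite !inE sS tS !orbT !tau'E.
case: (boolP [forall b, (src b \in S) == (tgt b \in S)]) => [/forallP cl|].
  have sCS : C \subset S.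
    apply/fintype.subsetP => v /connC[g /(@walk_closed _ _ _ [in S])]; apply=> //.
    by move=> p h q [b _ [-> _ ->]]; rewrite /= (eqP (cl b)).
  by have := subset_leq_card sCS; rewrite cardS leqNgt ltkC.
rewrite negb_forall => /existsP[b bS].
have bT : b \notin T.
  by apply: contra bS => /tauT[-> ->].
have wb : walk (edge_in (b |: T)) (src b) (fg_gen b) (tgt b).
  by apply: walk_edge; exists b; rewrite ?setU11.
have wS x : x \in S -> walk (edge_in (b |: T)) r (tau x) x.
  by move=> xS; apply: walk_edge_in_sub (walkT _ xS); apply: finset.subsetU1.
case: (boolP (src b \in S)) bS => [sS|sS].
  rewrite eq_sym eqb_id => tS.
  apply: (add (tgt b) b (tau (src b) * fg_gen b)) => //.
  - exact: walk_trans (wS _ sS) wb.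
  - by rewrite inE sS orbT.
  - by rewrite finset.setU11.
  - by rewrite /= eqxx; case: eqP => // e; rewrite -e sS in tS.
rewrite eq_sym eqbF_neg negbK => tS.
apply: (add (src b) b (tau (tgt b) * (fg_gen b)^-1)) => //.
- exact: walk_trans (wS _ tS) (walk_sym wb).
- by rewrite finset.setU11.
- by rewrite inE tS orbT.
- by rewrite /= eqxx mulgVK; case: eqP => // e; rewrite -e tS in sS.
Qed.

(** The basis consists of the labels tau (src b) b (tau (tgt b))^-1, for the
edges b outside the tree. They generate since this label is trivial for b in
the tree, so that [walk_cocycle] applies with phi = tau. They are free since
the morphism psi that kills the letters of the tree sends tau to 1, hence each
of these labels to its letter. The bound on #|C| matters only because of the
truncated subtraction: without it, a tree would have #|C| = #|A| + 1 and the
right-hand side would be 1 instead of 0. *)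
Lemma graph_rank :
  #|C| <= #|A| ->
  has_rank (loops (edge_in finset.setT) r) (#|A| - #|C| + 1).
Proof.
have [T [tau [cardT taur walkT tauT]]] := exists_spanning_tree.
move=> leCA; pose D := ~: T.
have <- : #|D| = (#|A| - #|C| + 1)%N.
  by rewrite addnBAC // addn1 -cardT -(cardsC T) subSS addKn.
pose X (i : 'I_#|D|) :=
  let b := enum_val i in tau (src b) * fg_gen b * (tau (tgt b))^-1.
pose psi b : freeGroup 'I_#|D| :=
  if [pick i : 'I_#|D| | enum_val i == b] is Some i then fg_gen i else 1.
have psiT b : b \in T -> psi b = 1.
  move=> bT; rewrite /psi; case: pickP => // i /eqP bE.
  by have := enum_valP i; rewrite bE inE bT.
have psiD i : psi (enum_val i) = fg_gen i.
  rewrite /psi; case: pickP => [j /eqP/enum_val_inj -> //|/(_ i)].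
  by rewrite eqxx.
have psi_tau v : v \in C -> fg_lift psi (tau v) = 1.
  move=> /walkT wv; have := @walk_cocycle _ _ _ (fg_lift psi @^-1` [set 1])
    (fun=> 1) _ _ _ _ _ wv.
  rewrite mul1g invg1 mulg1; apply.
    apply/is_subgroupP; split=> /= [|g h gK hK|g gK].
    - exact: fg_lift1.
    - by rewrite fg_liftM gK hK mulg1.
    - by rewrite fg_liftV gK invg1.
  move=> p g q [b bT [_ -> _]] /=; rewrite mul1g mulg1.
  by rewrite fg_lift_gen psiT.
exists X; split.
  apply: (can_inj (g := fg_lift psi)); apply: fg_liftK => i.
  by rewrite !fg_liftM fg_liftV !psi_tau // fg_lift_gen mul1g invg1 mulg1 psiD.
apply/seteqP; split=> [_ [x _ <-] | g wg].
  apply: fg_lift_subgroup => [|i]; first exact: loops_is_subgroup.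
  have sT : T \subset finset.setT by apply: finset.subsetT.
  have wsrc := walk_edge_in_sub sT (walkT _ (srcC (enum_val i))).
  have wtgt := walk_edge_in_sub sT (walkT _ (tgtC (enum_val i))).
  apply: walk_trans (walk_sym wtgt); apply: (walk_trans wsrc).
  by apply: walk_edge; exists (enum_val i); rewrite ?inE.
have := walk_cocycle (phi := tau) (range_fg_lift_is_subgroup X) _ wg.
rewrite taur mul1g invg1 mulg1; apply=> {g wg} _ _ _ [b _ [-> -> ->]].
case: (boolP (b \in T)) => [/tauT ->|bT].
  by rewrite mulgV; exists 1; rewrite ?fg_lift1.
have bD : b \in D by rewrite inE.
exists (fg_gen (enum_rank_in bD b)) => //.
by rewrite fg_lift_gen /X enum_rankK_in.
Qed.

End GraphRank.

(** * Occurrences of a factor *)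

Section Occurrences.
Variable A : finType.
Implicit Types (b : A) (w x y z s t p q : seq A).

(** An occurrence of w is the last one in x when what follows it is shortest. *)
Definition last_occ w x z : Prop :=
  (exists y, x = y ++ w ++ z) /\
  forall y' z', x = y' ++ w ++ z' -> size z <= size z'.

Lemma last_occ_exists w x : infix w x -> exists z, last_occ w x z.
Proof.
case/infixP => y0 [z0 e0].
pose P n := `[< exists y z, x = y ++ w ++ z /\ size z = n >].
have exP : exists n, P n by exists (size z0); apply/asboolP; exists y0, z0.
case: (ex_minnP exP) => _ /asboolP[y [z [e <-]]] zmin.
exists z; split=> [|y' z' e']; first by exists y.
by apply: zmin; apply/asboolP; exists y', z'.
Qed.

(** Sliding a window by one letter either completes a new occurrence of w at its
right end, or leaves the last occurrence where it is. In the second case, the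
last occurrence in x does not fall off on the left, as the occurrence that the
new window shows would lie strictly to its right in x. *)
Lemma last_occ_step w x b z z' :
  last_occ w x z -> last_occ w (behead (rcons x b)) z' ->
  z' = [::] \/ z' = rcons z b.
Proof.
move=> [[y ex] zmin] [[y' ex'] zmin'].
case/lastP: z' ex' zmin' => [|z1 b'] ex' zmin'; [by left | right].
have {ex'} [c ex'] : exists c, rcons x b = (c :: y' ++ w ++ z1) ++ [:: b'].
  case E : (rcons x b) ex' => [|c x'] /= ex'; first by case: (x) E.
  by exists c; rewrite ex' -cats1 -!catA.
move: ex'; rewrite cats1 => /rcons_inj[exc eb]; rewrite -eb in zmin' *.
have le1 : size z <= size z1 by apply: (zmin (c :: y')).
case: y ex => [|c' y] ex.
  have := congr1 size exc; rewrite ex /= !size_cat => e.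
  suff : size w + size z < size w + size z by rewrite ltnn.
  rewrite {2}e ltnS; apply: leq_trans (leq_addl _ _).
  by rewrite leq_add2l.
have le2 : size z1 <= size z.
  have := zmin' y (rcons z b); rewrite !size_rcons ltnS; apply.
  by rewrite ex rcons_cat /= -!rcons_cat.
have : (c' :: y ++ w) ++ z == (c :: y' ++ w) ++ z1.
  by rewrite /= -!catA -exc ex.
have esz : size z = size z1 by apply/eqP; rewrite eqn_leq le1.
rewrite eqseq_cat; first by case/andP => _ /eqP ->.
have := congr1 size exc; rewrite ex /= !size_cat esz => /eqP.
by rewrite eqSS !addnA eqn_add2r => /eqP ->.
Qed.

Lemma occurrences_return w s t :
  s <> [::] -> w ++ s = t ++ w ->
  (forall p q, w ++ s = p ++ w ++ q -> p = [::] \/ q = [::]) ->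
  occurrences w (w ++ s) = 2.
Proof.
move=> s0 est only; rewrite /occurrences.
have szt : size t = size s.
  apply/eqP; rewrite -(eqn_add2r (size w)) -size_cat -est size_cat.
  by rewrite addnC.
have s0' : size s != 0 by case: (s) s0.
rewrite (@eq_in_count _ _ (predU (pred1 0) (pred1 (size s)))); last first.
  move=> i; rewrite mem_iota add0n ltnS => /andP[_ lei] /=.
  apply/idP/orP => [/prefixP[q eq]|[]/eqP ei]; first last; rewrite ?ei.
  - by rewrite est -szt drop_size_cat // prefix_refl.
  - by rewrite drop0 prefix_prefix.
  have ews : w ++ s = take i (w ++ s) ++ w ++ q by rewrite -eq cat_take_drop.
  case: (only _ _ ews) => [p0|q0].
    by left; rewrite -(size_takel lei) p0.
  right; have := congr1 size ews; rewrite q0 cats0 !size_cat size_takel //.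
  by rewrite addnC => /eqP; rewrite eqn_add2r eq_sym.
have disj : predI (pred1 0) (pred1 (size s)) =1 pred0.
  by move=> i /=; case: eqP => // ->; rewrite eq_sym (negPf s0').
rewrite -[LHS]addn0 -[X in _ + X](count_pred0 (iota 0 (size (w ++ s)).+1)).
rewrite -(eq_count disj) count_predUI.
rewrite !count_uniq_mem ?iota_uniq // !mem_iota /= add0n size_cat ltnS.
by rewrite leq_addl.
Qed.

End Occurrences.

(** * Rauzy graphs *)

Section Rauzy.
Variables (A : finType) (L : set (seq A)).
Implicit Types (a b : A) (u v w x y s t : seq A) (g : freeGroup A).

(** The label of an edge is its last letter, so that forgetting the first letters
of the vertices preserves labels. *)
Definition rauzy m x g y : Prop :=
  size x = m /\
  exists2 b, L (rcons x b) & g = fg_gen b /\ y = behead (rcons x b).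

Lemma rauzy_size m x g y : rauzy m x g y -> size y = m.
Proof. by case=> <- [b _ [_ ->]]; rewrite size_behead size_rcons. Qed.

Hypothesis L_factor : forall u w, infix u w -> L w -> L u.

Lemma L_catl u v : L (u ++ v) -> L u.
Proof. by apply: L_factor; rewrite prefixW // prefix_prefix. Qed.

Lemma L_catr u v : L (u ++ v) -> L v.
Proof. by apply: L_factor; rewrite suffixW // suffix_suffix. Qed.

Lemma rauzy_walk m x s t y :
  size x = m -> size y = m -> x ++ s = t ++ y -> L (x ++ s) ->
  walk (rauzy m) x (fg_word s) y.
Proof.
elim: s t x => [|b s IH] t x szx szy exy Lxs.
  have t0 : t = [::].
    apply/nilP; rewrite /nilp -(eqn_add2r m) -{1}szy -size_cat -exy.
    by rewrite cats0 szx.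
  move: exy; rewrite t0 cats0 /= => <-.
  by rewrite /fg_word big_nil; apply: walk_nil.
case: t exy => [|c t] exy.
  have /eqP := congr1 size exy; rewrite size_cat szx szy /=.
  by rewrite -{2}[m]addn0 eqn_add2l.
move: exy Lxs; rewrite fg_word_cons -cat_rcons.
case E : (rcons x b) => [|c' x']; first by case: (x) E.
have szx' : size x' = m.
  by apply/eqP; rewrite -szx -eqSS -(size_rcons x b) E.
move=> /= [_ exy] Lxs; apply: (@walk_fwd _ _ _ _ _ x').
  by split=> //; exists b; rewrite E //; apply: (@L_catl _ s).
by apply: (IH t) => //; apply: (@L_catr [:: c']).
Qed.

(** An edge of E_{d,d}(t) between s and r is a walk labelled r from s t to t r;
two of them with the same r cancel. *)
Lemma ext_graph_walk d t (s s' : d.-tuple A) :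
  connect (extg_edge L d d t) (inl s) (inl s') ->
  walk (rauzy (d + size t)) (s ++ t) 1 (s' ++ t).
Proof.
(* Invariant along a path from s, stopping at a left or at a right vertex. *)
pose P (z : d.-tuple A + d.-tuple A) := match z with
  | inl s' => walk (rauzy (d + size t)) (s ++ t) 1 (s' ++ t)
  | inr r => walk (rauzy (d + size t)) (s ++ t) (fg_word r) (t ++ r)
  end.
have edge (p r : d.-tuple A) : extg_edge L d d t (inl p) (inr r) ->
    walk (rauzy (d + size t)) (p ++ t) (fg_word r) (t ++ r).
  move=> /and3P[_ _ /set_mem Lprt].
  apply: (@rauzy_walk _ _ _ p); rewrite -?catA ?size_cat ?size_tuple //.
  exact: addnC.
suff H z : connect (extg_edge L d d t) (inl s) z -> P z by apply: H.
move=> /connectP[q]; elim/last_ind: q z => [|q c IH] z /=.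
  by move=> _ ->; apply: walk_nil.
rewrite rcons_path last_rcons => /andP[/IH/(_ erefl) Pq qc ->].
case: (last _ q) c Pq qc => [p|r] [p'|r'] //= Pq.
  by move/edge; apply: walk_trans1.
by move=> /edge rp; rewrite -(mulgV (fg_word r)); apply: walk_trans (walk_sym rp).
Qed.

Hypothesis L_recurrent :
  forall u v, L u -> L v -> exists2 w, w <> [::] & L (u ++ w ++ v).

Lemma left_extend x : L x -> exists a, L (a :: x).
Proof.
move=> Lx; have [w] := L_recurrent Lx Lx.
case/lastP: w => // w a _; rewrite cat_rcons => /L_catr Lax.
by exists a; apply: L_catr Lax.
Qed.

Lemma left_extend_size n x : L x -> exists2 y, size y = n & L (y ++ x).
Proof.
move=> Lx; elim: n => [|n [y <- /left_extend[a Lay]]]; first by exists [::].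
by exists (a :: y).
Qed.

Hypothesis L_sc : suffix_connected L.

(** Suffix-connectedness of x, read in the Rauzy graph of order |x| + 1: with
x = p t, the embedded vertices a p and b p lie in one component of E_{d,d}(t),
and a p t = a x. *)
Lemma walk_left_ext a b x : x <> [::] -> L (a :: x) -> L (b :: x) ->
  walk (rauzy (size x).+1) (a :: x) 1 (b :: x).
Proof.
move=> x0 Lax Lbx; have Lx : L x by apply: (@L_catr [:: a]).
have [[|d] // /= dx conn] := L_sc Lx x0; rewrite ltnS in dx.
have sz : size (take d x) = d by apply: size_takel.
have tupP c : size (c :: take d x) == d.+1 by rewrite /= sz.
have im c : L (c :: x) -> Tuple (tupP c) \in nat_embedding_image L d.+1 x.
  move=> Lcx; apply/existsP; exists c; apply/andP; split=> //.
  apply/andP; split; apply: mem_set => //=.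
  by apply: (@L_catl [:: c] x).
have := ext_graph_walk (conn _ _ (im a Lax) (im b Lbx)).
by rewrite /= !cat_take_drop size_drop addSn subnKC.
Qed.

(** The free choice of a and b in the lift is what makes the induction work:
consecutive lifted edges need not match, and are glued by [walk_left_ext]. *)
Lemma rauzy_lift m x g y a b :
  0 < m -> size x = m -> walk (rauzy m) x g y ->
  L (a :: x) -> L (b :: y) -> walk (rauzy m.+1) (a :: x) g (b :: y).
Proof.
move=> m0 szx xy; elim: xy a b szx => {x g y}
  [x|x g y h z E _ IH|x g y h z E _ IH] a b szx Lax Lbz.
- by rewrite -szx; apply: walk_left_ext => // x0; rewrite -szx x0 in m0.
- have szy := rauzy_size E; have [_ [c Lxc [-> ye]]] := E.
  have [e Lexc] := left_extend Lxc.
  case: x => [|f x] in szx E Lxc ye Lax Lexc *; first by rewrite -szx in m0.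
  apply: (@walk_trans1 _ _ _ (e :: f :: x)).
    rewrite -szx; apply: walk_left_ext => //.
    by move: Lexc; rewrite -rcons_cons -cats1 => /L_catl.
  apply: (@walk_fwd _ _ _ _ _ (f :: y)); last by apply: IH => //; rewrite ye.
  split; first by rewrite /= -szx.
  by exists c => //; rewrite ye.
- have szy := E.1; have [_ [c Lyc [-> xe]]] := E.
  have [e Leyc] := left_extend Lyc.
  case: y => [|f y] in szy E Lyc xe IH Leyc *; first by rewrite -szy in m0.
  apply: (@walk_trans1 _ _ _ (f :: x)).
    rewrite -{1}szx; apply: walk_left_ext => //; last by rewrite xe.
    by move=> x0; rewrite -szx x0 in m0.
  apply: (@walk_bwd _ _ _ _ _ (e :: f :: y)); last first.
    by apply: IH => //; move: Leyc; rewrite -rcons_cons -cats1 => /L_catl.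
  split; first by rewrite /= -szy.
  by exists c => //; rewrite xe.
Qed.

Lemma rauzy_project m x g y :
  walk (rauzy m.+1) x g y -> walk (rauzy m) (behead x) g (behead y).
Proof.
apply: walk_map => {}x {}g {}y [szx [b Lxb [-> ->]]]; apply: walk_edge.
case: x szx Lxb => // a x [szx] Laxb; split => //=.
by exists b => //; apply: (@L_catr [:: a]).
Qed.

(** In a suffix-connected language the loop group at a word is already that of
any of its nonempty suffixes. *)
Lemma loops_rauzy_cat y x : x <> [::] -> L (y ++ x) ->
  loops (rauzy (size (y ++ x))) (y ++ x) = loops (rauzy (size x)) x.
Proof.
move=> x0; elim: y => //= a y IH Layx.
have Lyx : L (y ++ x) by apply: (@L_catr [:: a]).
rewrite -IH //; apply/seteqP; split=> g /=; first exact: rauzy_project.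
move=> wg; apply: rauzy_lift => //; rewrite size_cat.
by case: x x0 {IH Layx Lyx wg} => // b x _; rewrite addnS.
Qed.

(** Reading b after a word whose last occurrence of w = u v is followed by z, and
ending with w again, completes a return: w z b has w as a prefix and as a
suffix and, by the choice of z, nowhere else. Writing v z b = r v, the word r
is in the return set of (u, v). *)
Lemma return_group_first_return u v x b z :
  u ++ v <> [::] -> L (rcons x b) -> last_occ (u ++ v) x z ->
  suffix (u ++ v) (rcons x b) ->
  return_group L u v (fg_word (rcons z b) ^ (fg_word v)^-1).
Proof.
move=> w0 Lxb [[y ex] zmin] /suffixP[y' exb].
pose s := rcons z b; set w := u ++ v in w0 ex zmin exb *.
have exb' : rcons x b = y ++ w ++ s by rewrite ex !rcons_cat.
have Lws : L (w ++ s) by move: Lxb; rewrite exb' => /L_catr.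
have [t est] : exists t, w ++ s = t ++ w.
  exists (take (size s) (w ++ s)).
  rewrite -{1}(cat_take_drop (size s) (w ++ s)); congr (_ ++ _).
  have <- : drop (size y) (rcons x b) = w ++ s by rewrite exb' drop_size_cat.
  rewrite drop_drop exb drop_size_cat //.
  have := congr1 size exb; rewrite exb' !size_cat => /eqP.
  by rewrite addnCA addnC eqn_add2r => /eqP <-; rewrite addnC.
have only p q : w ++ s = p ++ w ++ q -> p = [::] \/ q = [::].
  case/lastP: q => [|q b'] epq; [by right | left].
  have : rcons (y ++ w ++ z) b = rcons (y ++ p ++ w ++ q) b'.
    by rewrite !rcons_cat -epq.
  case/rcons_inj => e _; have := zmin (y ++ p) q; rewrite ex e -catA.
  move=> /(_ erefl) lezq; have := congr1 size e; rewrite !size_cat => /eqP.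
  rewrite eqn_add2l addnCA eqn_add2l => /eqP ez.
  by apply/nilP; rewrite /nilp -leqn0 -(leq_add2r (size q)) -ez.
have s0 : s <> [::] by rewrite /s; case: (z).
pose r := take (size s) (v ++ s).
have erv : v ++ s = r ++ v.
  rewrite -{1}(cat_take_drop (size s) (v ++ s)); congr (_ ++ _).
  have : drop (size t) (w ++ s) = w by rewrite est drop_size_cat.
  have -> : size t = size s.
    apply/eqP; rewrite -(eqn_add2r (size w)) -size_cat -est size_cat.
    by rewrite addnC.
  move=> /(congr1 (drop (size u))); rewrite drop_drop addnC -drop_drop.
  by rewrite /w -catA (drop_size_cat _ erefl) (drop_size_cat _ erefl).
have eurv : u ++ r ++ v = w ++ s by rewrite -erv catA.
have -> : fg_word s ^ (fg_word v)^-1 = fg_word r.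
  apply: (mulIg (fg_word v)); rewrite -fg_word_cat -erv fg_word_cat.
  by rewrite conjgE invgK mulgA mulgVK.
apply: sub_gen_smallest; exists r => //; split.
- by move: Lws; rewrite -eurv => /L_catr/L_catl.
- by rewrite eurv.
- by rewrite eurv prefix_prefix.
- by rewrite eurv est suffix_suffix.
- by rewrite eurv; apply: occurrences_return est only.
Qed.

Hypothesis L_unif :
  forall u, L u -> exists N, forall w, L w -> N <= size w -> infix u w.

(** Group-theoretic form of the correspondence between returns to u v and loops
at u v: u r v = u v s forces r = v s v^-1. *)
Lemma return_group_loops u v h :
  u ++ v <> [::] -> L (u ++ v) ->
  return_group L u v h <->
  loops (rauzy (size (u ++ v))) (u ++ v) (h ^ fg_word v).
Proof.
move=> w0 Lw; split.
  move: h; apply: smallest_sub.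
    exact/conj_is_subgroup/loops_is_subgroup.
  move=> _ [r [_ Lurv /prefixP[s es] /suffixP[t et] _] <-] /=.
  have erv : r ++ v = v ++ s.
    by apply/eqP; move/eqP: es; rewrite -catA eqseq_cat // eqxx.
  have -> : fg_word r ^ fg_word v = fg_word s.
    rewrite conjgE -fg_word_cat erv fg_word_cat; exact: mulKg.
  by apply: (rauzy_walk _ _ (t := t)); rewrite -?es.
set w := u ++ v in w0 Lw *.
(* The loops at w are replaced by the loops at a longer word y w, of a length at
   which every vertex of the Rauzy graph contains w. *)
have [N wN] := L_unif Lw.
have [y szy Lyw] := left_extend_size N Lw.
rewrite -(loops_rauzy_cat w0 Lyw) => wh.
pose M := size (y ++ w).
have leNM : N <= M by rewrite /M size_cat szy leq_addr.
pose phi x : freeGroup A := fg_word (xget [::] (last_occ w x)).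
pose H := [set g | return_group L u v (g ^ (fg_word v)^-1)].
have subH : is_subgroup H by apply/conj_is_subgroup/generated_is_subgroup.
have phiP x : L x -> size x = M -> last_occ w x (xget [::] (last_occ w x)).
  move=> Lx szx; apply: xgetPex; apply: last_occ_exists; apply: wN => //.
  by rewrite szx.
have phi1 : phi (y ++ w) = 1.
  have [_ /(_ y [::])] := phiP _ Lyw erefl; rewrite cats0 leqn0 => /(_ erefl).
  by move=> /nilP z0; rewrite /phi z0 /fg_word big_nil.
suff : H (phi (y ++ w) * h ^ fg_word v * (phi (y ++ w))^-1).
  by rewrite phi1 mul1g invg1 mulg1 /H /= conjgK.
apply: (walk_cocycle subH) wh => x g x' E.
have szx' := rauzy_size E; have [szx [b Lxb [-> ex']]] := E.
have Lx : L x by move: Lxb; rewrite -cats1 => /L_catl.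
have Lx' : L x'.
  rewrite ex'; case F : (rcons x b) Lxb => [|c x1] //=; exact: (@L_catr [:: c]).
have := phiP _ Lx szx; have := phiP _ Lx' szx'; rewrite /phi.
move: (xget _ _) (xget _ _) => z' z oz' oz; rewrite -fg_word_rcons.
(* The two outcomes of a step: a return is completed, whose label is in H, or
   phi grows by the letter read and the label of the edge becomes trivial. *)
rewrite ex' in oz'; case: (last_occ_step oz oz') => ez'; rewrite ez' in oz' *.
  rewrite [fg_word [::]]big_nil invg1 mulg1.
  apply: return_group_first_return oz _ => //; case: oz' => -[y' e] _.
  apply/suffixP; case F : (rcons x b) e => [|c x1] /= e; first by case: (x) F.
  by exists (c :: y'); rewrite e cats0.
rewrite mulgV; have /is_subgroupP[H1 _ _] := subH; exact: H1.
Qed.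

End Rauzy.

(** * The graph of components of the extension graph of the empty word *)

Section ComponentGraph.
Variables (A : finType) (L : set (seq A)).
Hypothesis A_sub_L : forall a : A, L [:: a].
Hypothesis L_factor : forall u w, infix u w -> L w -> L u.
Hypothesis L_recurrent :
  forall u v, L u -> L v -> exists2 w, w <> [::] & L (u ++ w ++ v).

Let e := extg_edge L 1 1 [::].

(** A walk in the Rauzy graph of order 1 that has just read b stands at the left
vertex b of E(epsilon), from where it continues along the extensions of b, and
it could read b only from a letter adjacent to the right vertex b. Components
are represented by their roots. *)
Definition comp_src (b : A) := root e (inr [tuple b]).
Definition comp_tgt (b : A) := root e (inl [tuple b]).
Definition comp_edge := edge_in comp_src comp_tgt finset.setT.

Let e_sym : connect_sym e.
Proof. exact/sym_connect_sym/extg_edge_sym. Qed.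

Lemma comp_tgt_src a b : L [:: a; b] -> comp_tgt a = comp_src b.
Proof.
move=> Lab; apply/(rootP e_sym)/connect1; apply/and3P; split.
- by apply/andP; split; apply/mem_set/A_sub_L.
- by apply/andP; split; apply/mem_set/A_sub_L.
- exact: mem_set.
Qed.

Lemma comp_src_tgt b : exists2 c, L [:: c; b] & comp_tgt c = comp_src b.
Proof.
have [c Lcb] := left_extend L_factor L_recurrent (A_sub_L b).
by exists c => //; apply: comp_tgt_src.
Qed.

(** The component graph arises from the Rauzy graph of order 1 by merging letters
that are joined by a walk with trivial label ([ext_graph_walk] with d = 1 and
t empty), and by then identifying the edges that read the same letter. *)
Lemma comp_walk_rauzy a g a' :
  walk (rauzy L 1) [:: a] g [:: a'] <->
  walk comp_edge (comp_tgt a) g (comp_tgt a').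
Proof.
split.
  apply: (@walk_map _ _ _ _ _ (fun x => comp_tgt (head a x))).
  move=> x h y [szx [b Lxb [-> ->]]]; apply: walk_edge.
  case: x szx Lxb => [|c []] //= _ Lcb.
  by exists b; rewrite ?inE // (comp_tgt_src Lcb).
have triv b c : comp_tgt b = comp_tgt c -> walk (rauzy L 1) [:: b] 1 [:: c].
  by move/(rootP e_sym)/(ext_graph_walk L_factor).
have edge b c : L [:: c; b] -> rauzy L 1 [:: c] (fg_gen b) [:: b].
  by move=> Lcb; split=> //; exists b.
suff lift p h q : walk comp_edge p h q -> forall c c',
    comp_tgt c = p -> comp_tgt c' = q -> walk (rauzy L 1) [:: c] h [:: c'].
  by move=> w; apply: lift w _ _ erefl erefl.
elim=> {a g a' p h q}
  [p|p g q h z [b _ [-> -> ->]] _ IH|p g q h z [b _ [-> -> ->]] _ IH] a a'.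
- by move=> <- /esym; apply: triv.
- have [c Lcb <-] := comp_src_tgt b => /triv wac eq.
  by apply: (walk_trans1 wac); apply: walk_fwd (edge _ _ Lcb) (IH _ _ erefl eq).
- have [c Lcb ec] := comp_src_tgt b => /triv wab eq.
  apply: (walk_trans1 wab); apply: walk_bwd (edge _ _ Lcb) (IH _ _ _ eq).
  exact: esym.
Qed.

Definition components := [set x | roots e x]%SET.

Lemma comp_src_in b : comp_src b \in components.
Proof. by rewrite inE; apply: roots_root. Qed.

Lemma comp_tgt_in b : comp_tgt b \in components.
Proof. by rewrite inE; apply: roots_root. Qed.

Lemma componentsP v : v \in components -> exists a, v = comp_tgt a.
Proof.
rewrite inE => /eqP <-; case: v => -[[|b []] // i].
  by exists b; rewrite /comp_tgt; congr (root e (inl _)); apply: val_inj.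
have [c _ ec] := comp_src_tgt b.
by exists c; rewrite ec; congr (root e (inr _)); apply: val_inj.
Qed.

Lemma card_components : #|components| = extg_ncomp L 1 1 [::].
Proof.
have vertex x : x \in extg_vertex L 1 1 [::].
  by case: x => -[[|b []] // i]; apply/andP; split; apply/mem_set/A_sub_L.
rewrite /extg_ncomp /n_comp_mem cardsE; apply: eq_card => x.
by rewrite [RHS]inE /= vertex andbT.
Qed.

(** Each component contains a left vertex, because every letter can be extended
to the left. *)
Lemma leq_card_components : #|components| <= #|A|.
Proof.
apply: leq_trans (leq_imset_card comp_tgt A).
apply/subset_leq_card/fintype.subsetP => v /componentsP[a ->].
exact: finset.imset_f.
Qed.

Lemma components_connected a v :
  v \in components -> exists g, walk comp_edge (comp_tgt a) g v.
Proof.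
move=> /componentsP[b ->].
have [w _ Lawb] := L_recurrent (A_sub_L a) (A_sub_L b).
exists (fg_word (w ++ [:: b])); apply/comp_walk_rauzy.
by apply: (rauzy_walk L_factor (t := a :: w)) => //=; rewrite -catA.
Qed.

Lemma comp_loops_rank a :
  has_rank (loops comp_edge (comp_tgt a)) (#|A| - extg_ncomp L 1 1 [::] + 1).
Proof.
rewrite -card_components; apply: graph_rank.
- exact: comp_tgt_in.
- exact: comp_src_in.
- exact: comp_tgt_in.
- exact: components_connected.
- exact: leq_card_components.
Qed.

Hypothesis L_sc : suffix_connected L.
Hypothesis L_unif :
  forall u, L u -> exists N, forall w, L w -> N <= size w -> infix u w.

(** With a single component, every letter labels a loop. *)
Lemma comp_loops_setT a :
  extg_ncomp L 1 1 [::] = 1%N -> loops comp_edge (comp_tgt a) = setT.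
Proof.
rewrite -card_components => /eqP/cards1P[r er].
have inr v : v \in components -> v = r by rewrite er => /set1P.
apply/seteqP; split=> // g _; rewrite -[g]fg_lift_id.
apply: fg_lift_subgroup => [|b]; first exact: loops_is_subgroup.
apply: walk_edge; exists b; rewrite ?inE //.
by rewrite (inr _ (comp_tgt_in a)) (inr _ (comp_src_in b)) (inr _ (comp_tgt_in b)).
Qed.

(** Returns to the empty word are the letters: a word contains the empty word at
exactly two positions when its length is 1. *)
Lemma return_group_nil : return_group L [::] [::] = setT.
Proof.
apply/seteqP; split=> // g _; rewrite -[g]fg_lift_id.
apply: (fg_lift_subgroup (H := return_group L [::] [::])) => [|b].
  exact: generated_is_subgroup.
apply: sub_gen_smallest; exists [:: b]; last by rewrite /fg_word big_seq1.
by split => //=.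
Qed.

(** For a nonempty u v one passes from u v to its last letter by [loops_rauzy_cat]; for empty u and v
both sides are the whole of F(A), since then E(epsilon) is connected. *)
Lemma return_group_comp_loops a u v :
  return_pair L u v ->
  conjugate_subgroups (loops comp_edge (comp_tgt a)) (return_group L u v).
Proof.
case=> Lw; case: (eqVneq (u ++ v) [::]) => [|/eqP w0 _].
  case: u v {Lw} => [|//] [|//] _ /(_ erefl) c1.
  rewrite comp_loops_setT // return_group_nil.
  by apply: (conjugate_subgroups_of (g := 1)).
have [g wg] : exists g, walk comp_edge (comp_tgt a) g (comp_tgt (last a (u ++ v))).
  exact/components_connected/comp_tgt_in.
apply: conjugate_subgroups_trans (loops_conjugate wg) _.
apply: (conjugate_subgroups_of (g := fg_word v)) => h.
rewrite return_group_loops //.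
case/lastP: (u ++ v) w0 Lw {wg} => // y b _; rewrite last_rcons -cats1 => Lyb.
rewrite loops_rauzy_cat //; exact: comp_walk_rauzy.
Qed.

Lemma return_pair_inhabited u v : return_pair L u v -> inhabited A.
Proof.
case=> Lw; case: (u ++ v) => [/(_ erefl)|a w _]; last exact: inhabits a.
rewrite -card_components => c1.
have /card_gt0P[x /componentsP[a _]] : 0 < #|components| by rewrite c1.
exact: inhabits a.
Qed.

End ComponentGraph.

Theorem theorem1p1 (A : finType) (L : set (seq A))
    (L_sc : suffix_connected L) (L_ur : uniformly_recurrent L)
    (A_sub_L : forall a : A, L [:: a]) :
  (forall u v u' v' : seq A, return_pair L u v -> return_pair L u' v' ->
     conjugate_subgroups (return_group L u v) (return_group L u' v')) /\
  (forall u v : seq A, return_pair L u v ->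
     has_rank (return_group L u v) (#|A| - extg_ncomp L 1 1 [::] + 1)).
Proof.
have [[L_factor L_rec] L_unif] := L_ur.
have conj := return_group_comp_loops A_sub_L L_factor L_rec L_sc L_unif.
split=> [u v u' v' p p' | u v p].
  have [a] := return_pair_inhabited A_sub_L L_factor L_rec p.
  exact: conjugate_subgroups_trans
    (conjugate_subgroups_sym (conj a _ _ p)) (conj a _ _ p').
have [a] := return_pair_inhabited A_sub_L L_factor L_rec p.
exact: has_rank_conj (conj a _ _ p) (comp_loops_rank A_sub_L L_factor L_rec a).
Qed.
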